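(* There is a 1-1 correspondence between skeletal $2$-term Nijenhuis $L_\infty$-algebras and third cocycles of Nijenhuis Lie algebras with coefficients in Nijenhuis representations.
   Context: All vector spaces are over a fixed field. 2-term $L_\infty$-algebras. A $2$-term $L_\infty$-algebra $(\mathcal{L}_1\xrightarrow{\partial}\mathcal{L}_0,l_2,l_3)$ is a $2$-term chain complex $\mathcal{L}_1\xrightarrow{\partial}\mathcal{L}_0$ with an antisymmetric bilinear map $l_2:\mathcal{L}_i\times\mathcal{L}_j\to\mathcal{L}_{i+j}$ ($0\le i,j,i+j\le1$; so $l_2(h,x)=-l_2(x,h)$) and an antisymmetric trilinear map $l_3:\mathcal{L}_0\times\mathcal{L}_0\times\mathcal{L}_0\to\mathcal{L}_1$ such that for all $x,y,z,w\in\mathcal{L}_0$ and $h,k\in\mathcal{L}_1$: $\partial l_2(x,h)=l_2(x,\partial h)$; $l_2(\partial h,k)=l_2(h,\partial k)$; $\partial l_3(x,y,z)=l_2(x,l_2(y,z))+l_2(y,l_2(z,x))+l_2(z,l_2(x,y))$; $l_3(x,y,\partial h)=l_2(x,l_2(y,h))+l_2(y,l_2(h,x))+l_2(h,l_2(x,y))$; and $l_2(x,l_3(y,z,w))-l_2(y,l_3(x,z,w))+l_2(z,l_3(x,y,w))-l_2(w,l_3(x,y,z))-l_3(l_2(x,y),z,w)+l_3(l_2(x,z),y,w)-l_3(l_2(x,w),y,z)-l_3(l_2(y,z),x,w)+l_3(l_2(y,w),x,z)-l_3(l_2(z,w),x,y)=0$. A homotopy Nijenhuis operator on it is a triple $(\mathcal{N}_0,\mathcal{N}_1,\mathcal{N}_2)$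 of linear maps $\mathcal{N}_0:\mathcal{L}_0\to\mathcal{L}_0$, $\mathcal{N}_1:\mathcal{L}_1\to\mathcal{L}_1$ and an antisymmetric bilinear map $\mathcal{N}_2:\mathcal{L}_0\times\mathcal{L}_0\to\mathcal{L}_1$ such that, for all $x,y,z\in\mathcal{L}_0$ and $h\in\mathcal{L}_1$, writing $l_2^{\mathcal{N}}(x,y)=l_2(\mathcal{N}_0x,y)+l_2(x,\mathcal{N}_0y)-\mathcal{N}_0l_2(x,y)$: (1) $\partial\mathcal{N}_1=\mathcal{N}_0\partial$; (2) $\mathcal{N}_0(l_2^{\mathcal{N}}(x,y))-l_2(\mathcal{N}_0x,\mathcal{N}_0y)=\partial\mathcal{N}_2(x,y)$; (3) $\mathcal{N}_1\big(l_2(\mathcal{N}_0x,h)+l_2(x,\mathcal{N}_1h)-\mathcal{N}_1l_2(x,h)\big)-l_2(\mathcal{N}_0x,\mathcal{N}_1h)=\mathcal{N}_2(x,\partial h)$; (4) $l_2(\mathcal{N}_0x,\mathcal{N}_2(y,z))+l_2(\mathcal{N}_0y,\mathcal{N}_2(z,x))+l_2(\mathcal{N}_0z,\mathcal{N}_2(x,y))-\mathcal{N}_2(l_2^{\mathcal{N}}(x,y),z)-\mathcal{N}_2(l_2^{\mathcal{N}}(y,z),x)-\mathcal{N}_2(l_2^{\mathcal{N}}(z,x),y)-\mathcal{N}_1\big(l_2(x,\mathcal{N}_2(y,z))+l_2(y,\mathcal{N}_2(z,x))+l_2(z,\mathcal{N}_2(x,y))-\mathcal{N}_2(l_2(x,y),z)-\mathcal{N}_2(l_2(y,z),x)-\mathcal{N}_2(l_2(z,x),y)\big)$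 $=l_3(\mathcal{N}_0x,\mathcal{N}_0y,\mathcal{N}_0z)-\mathcal{N}_1\big(l_3(\mathcal{N}_0x,\mathcal{N}_0y,z)+l_3(\mathcal{N}_0x,y,\mathcal{N}_0z)+l_3(x,\mathcal{N}_0y,\mathcal{N}_0z)\big)+\mathcal{N}_1^2\big(l_3(\mathcal{N}_0x,y,z)+l_3(x,\mathcal{N}_0y,z)+l_3(x,y,\mathcal{N}_0z)\big)-\mathcal{N}_1^3l_3(x,y,z)$. A $2$-term Nijenhuis $L_\infty$-algebra is a $2$-term $L_\infty$-algebra together with a homotopy Nijenhuis operator on it; it is skeletal if $\partial=0$. Nijenhuis Lie algebras. A Nijenhuis Lie algebra $(\mathfrak{g},[\cdot,\cdot]_\mathfrak{g},N)$ is a Lie algebra with a linear map $N:\mathfrak{g}\to\mathfrak{g}$ satisfying $[Nx,Ny]_\mathfrak{g}=N([x,y]^N_\mathfrak{g})$ for all $x,y\in\mathfrak{g}$, where $[x,y]^N_\mathfrak{g}=[Nx,y]_\mathfrak{g}+[x,Ny]_\mathfrak{g}-N[x,y]_\mathfrak{g}$. A Nijenhuis representation of it is a triple $(\mathcal{V},\rho,S)$ with $(\mathcal{V},\rho)$ a representation of the Lie algebra $(\mathfrak{g},[\cdot,\cdot]_\mathfrak{g})$ and $S:\mathcal{V}\to\mathcal{V}$ linear with $\rho_{Nx}S(v)=S(\rho_{Nx}v+\rho_xS(v)-S(\rho_xv))$ for all $x\in\mathfrak{g}$, $v\in\mathcal{V}$. A third cocycle ($3$-cocycle) of $(\mathfrak{g},[\cdot,\cdot]_\mathfrak{g},N)$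 with coefficients in $(\mathcal{V},\rho,S)$ is a pair $(\chi,F)\in\mathrm{Hom}(\wedge^3\mathfrak{g},\mathcal{V})\oplus\mathrm{Hom}(\wedge^2\mathfrak{g},\mathcal{V})$ with $\delta_{\mathrm{CE}}(\chi)=0$ and $d_{N,S}(F)-\partial^{N,S}(\chi)=0$, where for $f\in\mathrm{Hom}(\wedge^n\mathfrak{g},\mathcal{V})$, $n\geq 1$, a hat denoting omission: $(\delta_{\mathrm{CE}}f)(x_1,\dots,x_{n+1})=\sum_{i}(-1)^{i+1}\rho_{x_i}f(x_1,\dots,\widehat{x_i},\dots,x_{n+1})+\sum_{i<j}(-1)^{i+j}f([x_i,x_j]_\mathfrak{g},x_1,\dots,\widehat{x_i},\dots,\widehat{x_j},\dots,x_{n+1})$; $(d_{N,S}f)(x_1,\dots,x_{n+1})=\sum_i(-1)^{i+1}\rho_{Nx_i}f(x_1,\dots,\widehat{x_i},\dots,x_{n+1})+\sum_{i<j}(-1)^{i+j}f([x_i,x_j]^N_\mathfrak{g},x_1,\dots,\widehat{x_i},\dots,\widehat{x_j},\dots,x_{n+1})-S((\delta_{\mathrm{CE}}f)(x_1,\dots,x_{n+1}))$; $(\partial^{N,S}f)(x_1,\dots,x_n)=\sum_{k=0}^n(-1)^kS^k\big(\sum_{|I|=k}f(y^I_1,\dots,y^I_n)\big)$ with $I\subseteq\{1,\dots,n\}$, $y^I_i=x_i$ if $i\in I$, $y^I_i=Nx_i$ otherwise. *)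

(* Defs.v *)
From HB Require Import structures.
From mathcomp Require Import all_boot all_order all_algebra.

Set Implicit Arguments.
Unset Strict Implicit.
Unset Printing Implicit Defensive.

Import GRing.Theory.
Local Open Scope ring_scope.

(* "Antisymmetric" means: zero as soon as two arguments coincide.  Since the
   ground field is arbitrary, this is the form which agrees with the usual
   meaning of Lie bracket and of Hom(/\^n g, V) in characteristic 2 as well;
   in other characteristics it is the change of sign under transpositions, see
   antisym2P and antisym3P below. *)
Definition antisym2 (U V : nmodType) (f : U -> U -> V) :=
  forall x, f x x = 0.

Definition antisym3 (U V : nmodType) (f : U -> U -> U -> V) :=
  forall x y, [/\ f x x y = 0, f x y x = 0 & f y x x = 0].

Section Trilinear.

Variables (K : fieldType) (U V : lmodType K).

Definition trilinear (f : U -> U -> U -> V) :=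
  [/\ forall y z, linear (fun x => f x y z),
      forall x z, linear (fun y => f x y z) &
      forall x y, linear (fun z => f x y z)].

Lemma antisym2P (f : U -> U -> V) : (2%:R : K) != 0 ->
    (forall x y z, f (x + y) z = f x z + f y z) ->
    (forall x y z, f x (y + z) = f x y + f x z) ->
  antisym2 f <-> (forall x y, f x y = - f y x).
Proof.
move=> nz2 fDl fDr; split=> [fA x y | fN x].
  apply/eqP; rewrite -addr_eq0; have := fA (x + y).
  by rewrite fDl !fDr !fA add0r addr0 => ->.
have /eqP: f x x + f x x = 0 by rewrite {1}fN addNr.
by rewrite -mulr2n -scaler_nat scaler_eq0 (negbTE nz2) => /eqP.
Qed.

Lemma antisym3P (f : U -> U -> U -> V) : (2%:R : K) != 0 -> trilinear f ->
  antisym3 f <-> (forall x y z, f y x z = - f x y z /\ f x z y = - f x y z).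
Proof.
move=> nz2 [f1 f2 f3].
have D (g : U -> V) : linear g -> forall u v, g (u + v) = g u + g v.
  by move=> gl u v; have := gl 1 u v; rewrite !scale1r.
have P12 z := @antisym2P (fun x y => f x y z) nz2
  (fun x y t => D _ (f1 t z) x y) (fun x y t => D _ (f2 x z) y t).
have P23 x := @antisym2P (f x) nz2
  (fun y z t => D _ (f2 x t) y z) (fun y z t => D _ (f3 x y) z t).
split=> [fA x y z | fN x y].
  split; first by apply: (P12 z).1 => u; have [] := fA u z.
  by apply: (P23 x).1 => u; have [] := fA u x.
have f12 : forall u v, f u u v = 0.
  by move=> u v; apply: (P12 v).2 => a b; have [] := fN b a v.
have f23 : forall u v, f v u u = 0.
  by move=> u v; apply: (P23 v).2 => a b; have [] := fN v b a.
by split; rewrite ?f12 ?f23 // (fN x x y).2 f12 oppr0.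
Qed.

End Trilinear.

(* The degree-preserving map l2 : L_i x L_j -> L_{i+j} is split into its three
   components l200, l201 and l210; the last two digits are the degrees (i, j). *)
Record linfty2 (K : fieldType) := LInfty2 {
  L0 : lmodType K;
  L1 : lmodType K;
  bd : {linear L1 -> L0};
  l200 : {bilinear L0 -> L0 -> L0};
  l201 : {bilinear L0 -> L1 -> L1};
  l210 : {bilinear L1 -> L0 -> L1};
  l3 : L0 -> L0 -> L0 -> L1;
  l200_antisym : antisym2 l200;
  l210E : forall h x, l210 h x = - l201 x h;
  l3_trilinear : trilinear l3;
  l3_antisym : antisym3 l3;
  bd_l2 : forall x h, bd (l201 x h) = l200 x (bd h);
  l2_bd : forall h k, l201 (bd h) k = l210 h (bd k);
  bd_l3 : forall x y z,
    bd (l3 x y z) =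
      l200 x (l200 y z) + l200 y (l200 z x) + l200 z (l200 x y);
  l3_bd : forall x y h,
    l3 x y (bd h) =
      l201 x (l201 y h) + l201 y (l210 h x) + l210 h (l200 x y);
  l2_l3 : forall x y z w,
    l201 x (l3 y z w) - l201 y (l3 x z w) + l201 z (l3 x y w)
    - l201 w (l3 x y z) - l3 (l200 x y) z w + l3 (l200 x z) y w
    - l3 (l200 x w) y z - l3 (l200 y z) x w + l3 (l200 y w) x z
    - l3 (l200 z w) x y = 0
}.

Definition deformed (V : zmodType) (br : V -> V -> V) (N : V -> V) (x y : V) :=
  br (N x) y + br x (N y) - N (br x y).

Record homotopy_nijenhuis (K : fieldType) (L : linfty2 K) := HomotopyNijenhuis {
  N0 : {linear L0 L -> L0 L};
  N1 : {linear L1 L -> L1 L};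
  N2 : {bilinear L0 L -> L0 L -> L1 L};
  N2_antisym : antisym2 N2;
  N_bd : forall h, bd L (N1 h) = N0 (bd L h);
  N_l200 : forall x y,
    N0 (deformed (l200 L) N0 x y) - l200 L (N0 x) (N0 y) = bd L (N2 x y);
  N_l201 : forall x h,
    N1 (l201 L (N0 x) h + l201 L x (N1 h) - N1 (l201 L x h))
    - l201 L (N0 x) (N1 h) = N2 x (bd L h);
  N_l3 : forall x y z,
    let l2N := deformed (l200 L) N0 in
    l201 L (N0 x) (N2 y z) + l201 L (N0 y) (N2 z x) + l201 L (N0 z) (N2 x y)
    - N2 (l2N x y) z - N2 (l2N y z) x - N2 (l2N z x) y
    - N1 (l201 L x (N2 y z) + l201 L y (N2 z x) + l201 L z (N2 x y)
          - N2 (l200 L x y) z - N2 (l200 L y z) x - N2 (l200 L z x) y)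
    = l3 (N0 x) (N0 y) (N0 z)
      - N1 (l3 (N0 x) (N0 y) z + l3 (N0 x) y (N0 z) + l3 x (N0 y) (N0 z))
      + N1 (N1 (l3 (N0 x) y z + l3 x (N0 y) z + l3 x y (N0 z)))
      - N1 (N1 (N1 (l3 x y z)))
}.

Record nijenhuis_linfty2 (K : fieldType) := NijenhuisLInfty2 {
  linf :> linfty2 K;
  hnij : homotopy_nijenhuis linf
}.

Definition skeletal (K : fieldType) (L : nijenhuis_linfty2 K) :=
  forall h : L1 L, bd L h = 0.

Record nijenhuis_lie (K : fieldType) (g : lmodType K) := NijenhuisLie {
  lie : {bilinear g -> g -> g};
  nij : {linear g -> g};
  lie_antisym : antisym2 lie;
  lie_jacobi : forall x y z,
    lie x (lie y z) + lie y (lie z x) + lie z (lie x y) = 0;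
  nij_lie : forall x y, lie (nij x) (nij y) = nij (deformed lie nij x y)
}.

Record nijenhuis_rep (K : fieldType) (g : lmodType K) (A : nijenhuis_lie g)
    (V : lmodType K) := NijenhuisRep {
  rho : {bilinear g -> V -> V};
  nijV : {linear V -> V};
  rho_lie : forall x y v,
    rho (lie A x y) v = rho x (rho y v) - rho y (rho x v);
  nij_rho : forall x v,
    rho (nij A x) (nijV v)
    = nijV (rho (nij A x) v + rho x (nijV v) - nijV (rho x v))
}.

Section Cochains.

Variables (K : fieldType) (g V : lmodType K).

Definition set_tuple n (x : n.-tuple g) (i : 'I_n) (a : g) : n.-tuple g :=
  [tuple if k == i then a else tnth x k | k < n].

Definition multilinear n (f : n.-tuple g -> V) :=
  forall (x : n.-tuple g) (i : 'I_n), linear (fun a => f (set_tuple x i a)).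

Definition alternating n (f : n.-tuple g -> V) :=
  forall (x : n.-tuple g) (i j : 'I_n),
    i != j -> tnth x i = tnth x j -> f x = 0.

(* Hom(/\^n g, V) *)
Record cochain n := Cochain {
  cochain_fun :> n.-tuple g -> V;
  cochain_multilinear : multilinear cochain_fun;
  cochain_alternating : alternating cochain_fun
}.

Definition omit n (x : n.+1.-tuple g) (i : 'I_n.+1) : n.-tuple g :=
  [tuple tnth x (lift i k) | k < n].

(* The Chevalley-Eilenberg formula for an arbitrary bracket br and an
   arbitrary operation r on V.
   Indices start at 0, which does not change the parity of i + j but turns
   (-1)^(i+1) into (-1)^i.  In the second sum i ranges over 'I_n.+1 with i < j,
   so that lift j i : 'I_n.+2 has value i, and omit (omit x j) i is x without
   its entries i and j. *)
Definition CE_formula (br : g -> g -> g) (r : g -> V -> V) n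
    (f : n.+1.-tuple g -> V) (x : n.+2.-tuple g) : V :=
  \sum_(i < n.+2) (-1) ^+ i *: r (tnth x i) (f (omit x i))
  + \sum_(j < n.+2) \sum_(i < n.+1 | (i < j)%N)
      (-1) ^+ (i + j) *:
        f [tuple of br (tnth x (lift j i)) (tnth x j) :: omit (omit x j) i].

Variables (A : nijenhuis_lie g) (R : nijenhuis_rep A V).

Definition deltaCE n (f : n.+1.-tuple g -> V) : n.+2.-tuple g -> V :=
  CE_formula (lie A) (rho R) f.

Definition dNS n (f : n.+1.-tuple g -> V) (x : n.+2.-tuple g) : V :=
  CE_formula (deformed (lie A) (nij A)) (fun a => rho R (nij A a)) f x
  - nijV R (deltaCE f x).

Definition partialNS n (f : n.-tuple g -> V) (x : n.-tuple g) : V :=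
  \sum_(k < n.+1) (-1) ^+ k *:
    iter k (nijV R)
      (\sum_(I : {set 'I_n} | #|I| == k)
         f [tuple if i \in I then tnth x i else nij A (tnth x i) | i < n]).

Record cocycle3 := Cocycle3 {
  cc_chi : cochain 3;
  cc_F : cochain 2;
  cc_deltaCE : forall x, deltaCE cc_chi x = 0;
  cc_dNS : forall x, dNS cc_F x - partialNS cc_chi x = 0
}.

End Cochains.

Record nijenhuis_cocycle3 (K : fieldType) := NijenhuisCocycle3 {
  cc_g : lmodType K;
  cc_V : lmodType K;
  cc_lie : nijenhuis_lie cc_g;
  cc_rep : nijenhuis_rep cc_lie cc_V;
  cc_cocycle : cocycle3 cc_rep
}.

(* Main.v *)
Require Import Defs.
From HB Require Import structures.
From mathcomp Require Import all_boot all_order all_algebra.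
From Stdlib Require Import FunctionalExtensionality ProofIrrelevance.

(** When [bd = 0] the axioms of a 2-term Nijenhuis L-infinity algebra fall
    apart into those of a third cocycle of a Nijenhuis Lie algebra.  Among the
    equations, [bd_l3] becomes the Jacobi identity of [l200] and [l3_bd] says
    that [l201] is an action of this Lie algebra on [L1]; [N_l200] and [N_l201]
    say that [N0] is a Nijenhuis operator and that [N1] makes the action a
    Nijenhuis representation; [l2_l3] is the equation [deltaCE l3 = 0], and
    [N_l3] is the equation [dNS N2 = partialNS l3]; [bd_l2], [l2_bd] and [N_bd]
    hold trivially.  Nothing else is in the structure, since [l210] is
    determined by [l201].

    The computation lies in the last two equations.  The general formulas for
    [deltaCE], [dNS] and [partialNS] are written with sums over positions and
    over sets of positions in a tuple, so they have to be expanded in degrees 2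
    and 3 ([CE_formula2], [CE_formula3], [partialNS3]).  The expansion in degree
    2 becomes the cyclic expression of [N_l3] because the cochain and both
    brackets are antisymmetric ([CE_formula2_cyclic]).

    For the bijection, [data_of_linfty2] and [data_of_cocycle] map both kinds of
    objects to the same type of raw operations without axioms.  Both maps are
    injective: they forget only proofs, up to [bd = 0] and the formula for
    [l210].  The two constructions [cocycle_of_skeletal] and
    [skeletal_of_cocycle] preserve these data, so they are inverse to each
    other. *)

Set Implicit Arguments.
Unset Strict Implicit.
Unset Printing Implicit Defensive.

Import GRing.Theory.
Local Open Scope ring_scope.

(** * Functions of two and three variables as functions on tuples *)

Local Notation i0 := ord0.
Local Notation i1 := (lift ord0 i0).
Local Notation i2 := (lift ord0 i1).
Local Notation i3 := (lift ord0 i2).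

Lemma tuple2_eta T (t : 2.-tuple T) : t = [tuple tnth t i0; tnth t i1].
Proof.
apply: eq_from_tnth; case=> [[|[|//]] i] /=; rewrite [RHS]/tnth /=.
all: by congr tnth; apply: val_inj.
Qed.

Lemma tuple3_eta T (t : 3.-tuple T) :
  t = [tuple tnth t i0; tnth t i1; tnth t i2].
Proof.
apply: eq_from_tnth; case=> [[|[|[|//]]] i] /=; rewrite [RHS]/tnth /=.
all: by congr tnth; apply: val_inj.
Qed.

Lemma tuple4_eta T (t : 4.-tuple T) :
  t = [tuple tnth t i0; tnth t i1; tnth t i2; tnth t i3].
Proof.
apply: eq_from_tnth; case=> [[|[|[|[|//]]]] i] /=; rewrite [RHS]/tnth /=.
all: by congr tnth; apply: val_inj.
Qed.

Section Currying.

Variables T W : Type.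

Definition uncurry2 (f : T -> T -> W) (t : 2.-tuple T) :=
  f (tnth t i0) (tnth t i1).

Definition uncurry3 (f : T -> T -> T -> W) (t : 3.-tuple T) :=
  f (tnth t i0) (tnth t i1) (tnth t i2).

Definition curry2 (f : 2.-tuple T -> W) x y := f [tuple x; y].

Definition curry3 (f : 3.-tuple T -> W) x y z := f [tuple x; y; z].

Lemma curry2E (f : 2.-tuple T -> W) t : uncurry2 (curry2 f) t = f t.
Proof. by rewrite [t in RHS]tuple2_eta. Qed.

Lemma curry2K (f : 2.-tuple T -> W) : uncurry2 (curry2 f) = f.
Proof. by apply: functional_extensionality => t; apply: curry2E. Qed.

Lemma curry3E (f : 3.-tuple T -> W) t : uncurry3 (curry3 f) t = f t.
Proof. by rewrite [t in RHS]tuple3_eta. Qed.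

Lemma curry3K (f : 3.-tuple T -> W) : uncurry3 (curry3 f) = f.
Proof. by apply: functional_extensionality => t; apply: curry3E. Qed.

End Currying.

Section CurryingCochains.

Variables (K : fieldType) (g V : lmodType K).

Lemma uncurry2_multilinear (f : {bilinear g -> g -> V}) :
  multilinear (uncurry2 f).
Proof.
move=> x [[|[|//]] i] c a b; rewrite /uncurry2 !tnth_mktuple -!val_eqE /=.
- exact: linearPl.
- exact: linearPr.
Qed.

Lemma uncurry2_alternating (f : g -> g -> V) :
  antisym2 f -> alternating (uncurry2 f).
Proof.
move=> fA x [[|[|//]] i] [[|[|//]] j] //= _.
all: by rewrite /uncurry2 !(tnth_nth 0) /= => ->; apply: fA.
Qed.

Lemma uncurry3_multilinear (f : g -> g -> g -> V) :
  trilinear f -> multilinear (uncurry3 f).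
Proof.
move=> [f1 f2 f3] x [[|[|[|//]]] i] c a b.
all: rewrite /uncurry3 !tnth_mktuple -!val_eqE /=.
- exact: f1.
- exact: f2.
- exact: f3.
Qed.

Lemma uncurry3_alternating (f : g -> g -> g -> V) :
  antisym3 f -> alternating (uncurry3 f).
Proof.
move=> fA x.
have f12 u v : f u u v = 0 by case: (fA u v).
have f13 u v : f u v u = 0 by case: (fA u v).
have f23 u v : f v u u = 0 by case: (fA u v).
move=> [[|[|[|//]]] i] [[|[|[|//]]] j] //= _.
all: by rewrite /uncurry3 !(tnth_nth 0) /= => ->.
Qed.

Lemma curry2_linearl (f : cochain g V 2) y : linear (curry2 f ^~ y).
Proof.
move=> c a b; have := cochain_multilinear f [tuple 0; y] i0 c a b.
by rewrite -!(curry2E f) /uncurry2 !tnth_mktuple.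
Qed.

Lemma curry2_linearr (f : cochain g V 2) x : linear (curry2 f x).
Proof.
move=> c a b; have := cochain_multilinear f [tuple x; 0] i1 c a b.
by rewrite -!(curry2E f) /uncurry2 !tnth_mktuple.
Qed.

Lemma curry2_antisym (f : cochain g V 2) : antisym2 (curry2 f).
Proof. by move=> x; apply: (@cochain_alternating _ _ _ _ f _ i0 i1). Qed.

Lemma curry3_trilinear (f : cochain g V 3) : trilinear (curry3 f).
Proof.
split=> [y z|x z|x y] c a b.
- have := cochain_multilinear f [tuple 0; y; z] i0 c a b.
  by rewrite -!(curry3E f) /uncurry3 !tnth_mktuple.
- have := cochain_multilinear f [tuple x; 0; z] i1 c a b.
  by rewrite -!(curry3E f) /uncurry3 !tnth_mktuple.
- have := cochain_multilinear f [tuple x; y; 0] i2 c a b.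
  by rewrite -!(curry3E f) /uncurry3 !tnth_mktuple.
Qed.

Lemma curry3_antisym (f : cochain g V 3) : antisym3 (curry3 f).
Proof.
have fA := @cochain_alternating _ _ _ _ f.
move=> x y; split.
- exact: (fA _ i0 i1).
- exact: (fA _ i0 i2).
- exact: (fA _ i1 i2).
Qed.

End CurryingCochains.

(** * Multilinear maps *)

Section MultilinearMaps.

Variable K : fieldType.
Implicit Types g U V W : lmodType K.

Lemma trilinear0r U V (f : U -> U -> U -> V) x y :
  trilinear f -> f x y 0 = 0.
Proof.
case=> _ _ f3; have /eqP := f3 x y 1 0 0.
by rewrite !scale1r addr0 -subr_eq subrr eq_sym => /eqP.
Qed.

Lemma bilinear_antisym2N U V (f : {bilinear U -> U -> V}) :
  antisym2 f -> forall x y, f x y = - f y x.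
Proof.
move=> fA x y; apply/eqP; rewrite -addr_eq0; have := fA (x + y).
by rewrite linearDl !linearDr /= !fA add0r addr0 => ->.
Qed.

Lemma deformed_antisym U (br : {bilinear U -> U -> U}) (N : {linear U -> U}) :
  antisym2 br -> forall x y, deformed br N x y = - deformed br N y x.
Proof.
move=> brA x y; have brN := bilinear_antisym2N brA; rewrite /deformed.
rewrite (brN (N x)) (brN x (N y)) (brN x y) linearN /= !opprD !opprK.
by rewrite [- br y _ - _]addrC.
Qed.

Definition pack_bilinear U V W (f : U -> V -> W)
    (fl : forall y, linear (f^~ y)) (fr : forall x, linear (f x)) :
    {bilinear U -> V -> W} :=
  HB.pack f (bilinear_isBilinear.Build K U V W _ _ f (fl, fr)).

Section OppFlip.

Variables (U V W : lmodType K) (f : {bilinear U -> V -> W}).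

Lemma opp_flip_linearl x : linear (fun v => - f x v).
Proof. by move=> a u v; rewrite linearPr opprD scalerN. Qed.

Lemma opp_flip_linearr v : linear (fun x => - f x v).
Proof. by move=> a x y; rewrite linearPl opprD scalerN. Qed.

(** The component [l210] that is forced by a given [l201]. *)
Definition opp_flip : {bilinear V -> U -> W} :=
  pack_bilinear opp_flip_linearl opp_flip_linearr.

End OppFlip.

Lemma linear_fun_inj U V (f f' : {linear U -> V}) :
  (f : U -> V) = f' -> f = f'.
Proof.
case: f f' => [f [[fD] [fZ]]] [f' [[fD'] [fZ']]] /= ff'; subst f'.
by rewrite (proof_irrelevance _ fD' fD) (proof_irrelevance _ fZ' fZ).
Qed.

Lemma bilinear_fun_inj U V W (f f' : {bilinear U -> V -> W}) :
  (f : U -> V -> W) = f' -> f = f'.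
Proof.
case: f f' => [f [[a b c d]]] [f' [[a' b' c' d']]] /= ff'; subst f'.
rewrite (proof_irrelevance _ a' a) (proof_irrelevance _ b' b).
by rewrite (proof_irrelevance _ c' c) (proof_irrelevance _ d' d).
Qed.

Lemma cochain_fun_inj U V n (f f' : cochain U V n) :
  (f : n.-tuple U -> V) = f' -> f = f'.
Proof.
case: f f' => [f a b] [f' a' b'] /= ff'; subst f'.
by rewrite (proof_irrelevance _ a' a) (proof_irrelevance _ b' b).
Qed.

Lemma cochain_curry2_inj U V (f f' : cochain U V 2) :
  curry2 f = curry2 f' -> f = f'.
Proof.
by move=> e; apply: cochain_fun_inj; rewrite -(curry2K f) e curry2K.
Qed.

Lemma cochain_curry3_inj U V (f f' : cochain U V 3) :
  curry3 f = curry3 f' -> f = f'.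
Proof.
by move=> e; apply: cochain_fun_inj; rewrite -(curry3K f) e curry3K.
Qed.

End MultilinearMaps.

(** * The coboundary formulas in degrees 2 and 3 *)

Section LowDegree.

Variables (K : fieldType) (g V : lmodType K).
Implicit Types (br : g -> g -> g) (r : g -> V -> V).

Lemma CE_formula2 br r (f : g -> g -> V) x y z :
  CE_formula br r (uncurry2 f) [tuple x; y; z] =
    r x (f y z) - r y (f x z) + r z (f x y)
    - f (br x y) z + f (br x z) y - f (br y z) x.
Proof.
rewrite /CE_formula; under [X in _ + X]eq_bigr => j _ do rewrite big_mkcond.
rewrite !big_ord_recl !big_ord0 /uncurry2 /= !addr0 !add0r.
rewrite !tnthS !tnth_mktuple !tnth0 /bump /=.
rewrite !(tnth_nth x) /= !expr0 !expr1 !expr2 !exprS !expr0.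
by rewrite ?mulrNN ?mulr1 ?mulrN ?mulN1r ?opprK !scale1r !scaleN1r !addrA.
Qed.

Lemma CE_formula3 br r (f : g -> g -> g -> V) x y z w :
  CE_formula br r (uncurry3 f) [tuple x; y; z; w] =
    r x (f y z w) - r y (f x z w) + r z (f x y w) - r w (f x y z)
    - f (br x y) z w + f (br x z) y w - f (br x w) y z
    - f (br y z) x w + f (br y w) x z - f (br z w) x y.
Proof.
rewrite /CE_formula; under [X in _ + X]eq_bigr => j _ do rewrite big_mkcond.
rewrite !big_ord_recl !big_ord0 /uncurry3 /= !addr0 !add0r.
rewrite !tnthS !tnth_mktuple !tnth0 /bump /=.
rewrite !(tnth_nth x) /= !expr0 !expr1 !expr2 !exprS !expr0.
rewrite ?mulrNN ?mulr1 ?mulrN ?mulN1r ?opprK !scale1r !scaleN1r !addrA.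
(* The pairs i < j are summed with j outermost, so (y, z) precedes (x, w). *)
by congr (_ + _ + _); rewrite addrAC.
Qed.

(** Antisymmetry turns the shuffle signs into a cyclic sum: the middle terms of
    the first and of the second sum change sign when [F x z], resp. [br x z], is
    replaced by [F z x], resp. [br z x]. *)
Lemma CE_formula2_cyclic br r (F : {bilinear g -> g -> V}) x y z :
    (forall x y, br x y = - br y x) -> (forall x v, r x (- v) = - r x v) ->
    antisym2 F ->
  CE_formula br r (uncurry2 F) [tuple x; y; z] =
    r x (F y z) + r y (F z x) + r z (F x y)
    - F (br x y) z - F (br y z) x - F (br z x) y.
Proof.
move=> brN rN /bilinear_antisym2N FN; rewrite CE_formula2.
by rewrite (FN x z) rN opprK (brN x z) linearNl [LHS]addrAC.
Qed.

(** Encoding a set by its membership bits makes the condition [#|I| = k] of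
    [partialNS] computable, as the bits add up to the cardinal. *)
Lemma big_set3 (G : {set 'I_3} -> V) :
  \sum_I G I = \sum_(a : bool) \sum_(b : bool) \sum_(c : bool)
     G [set i : 'I_3 | nth false [:: a; b; c] i].
Proof.
rewrite !pair_big /= (reindex (fun p : bool * bool * bool =>
  [set i : 'I_3 | nth false [:: p.1.1; p.1.2; p.2] i])) //=.
exists (fun I : {set 'I_3} => (i0 \in I, i1 \in I, i2 \in I)).
  by move=> [[a b] c] _; rewrite /= !inE.
move=> I _; apply/setP; case=> [[|[|[|//]]] i] /=; rewrite inE /=.
all: by congr (_ \in I); apply: val_inj.
Qed.

Variables (A : nijenhuis_lie g) (R : nijenhuis_rep A V).

Lemma partialNS3 (f : g -> g -> g -> V) x y z :
  let N := nij A in let S := nijV R in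
  partialNS R (uncurry3 f) [tuple x; y; z] =
    f (N x) (N y) (N z)
    - S (f (N x) (N y) z + f (N x) y (N z) + f x (N y) (N z))
    + S (S (f (N x) y z + f x (N y) z + f x y (N z)))
    - S (S (S (f x y z))).
Proof.
rewrite /partialNS /=.
have card3 a b c :
    #|[set i : 'I_3 | nth false [:: a; b; c] i]| = (a + b + c)%N.
  rewrite -sum1_card big_mkcond !big_ord_recl big_ord0 !inE /=.
  by case: a; case: b; case: c.
under eq_bigr => k _ do rewrite big_mkcond big_set3 !big_bool !card3
  /uncurry3 !tnth_mktuple !inE /=.
rewrite !big_ord_recl big_ord0 !(tnth_nth x) /= /bump /= !(addr0, add0r) /=.
rewrite !expr0 !expr1 !expr2 !exprS !expr0.
rewrite ?mulrNN ?mulr1 ?mulrN ?mulN1r ?opprK !scale1r !scaleN1r !addrA.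
(* The sums over subsets come out in the opposite order. *)
have rev (a b c : V) : a + b + c = c + b + a by rewrite addrC [a + b]addrC addrA.
by congr (_ - nijV R _ + nijV R (nijV R _) - _); rewrite rev.
Qed.

Lemma dNS2 (F : {bilinear g -> g -> V}) x y z : antisym2 F ->
  let lieN := deformed (lie A) (nij A) in
  dNS R (uncurry2 F) [tuple x; y; z] =
    rho R (nij A x) (F y z) + rho R (nij A y) (F z x) + rho R (nij A z) (F x y)
    - F (lieN x y) z - F (lieN y z) x - F (lieN z x) y
    - nijV R (rho R x (F y z) + rho R y (F z x) + rho R z (F x y)
              - F (lie A x y) z - F (lie A y z) x - F (lie A z x) y).
Proof.
move=> FA lieN; rewrite /dNS /deltaCE !CE_formula2_cyclic //.
- exact/bilinear_antisym2N/lie_antisym.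
- by move=> u v; rewrite linearNr.
- exact/deformed_antisym/lie_antisym.
- by move=> u v; rewrite linearNr.
Qed.

End LowDegree.

(** * The cocycle of a skeletal algebra *)

Section SkeletalToCocycle.

Variables (K : fieldType) (L : nijenhuis_linfty2 K) (sk : skeletal L).

Let N := N0 (hnij L).
Let S := N1 (hnij L).

Lemma skeletal_jacobi x y z :
  l200 L x (l200 L y z) + l200 L y (l200 L z x) + l200 L z (l200 L x y) = 0.
Proof. by rewrite -bd_l3 sk. Qed.

Lemma skeletal_nij_lie x y :
  l200 L (N x) (N y) = N (deformed (l200 L) N x y).
Proof. by apply/esym/eqP; rewrite -subr_eq0 N_l200 sk. Qed.

Definition skeletal_lie : nijenhuis_lie (L0 L) :=
  NijenhuisLie (@l200_antisym _ L) skeletal_jacobi skeletal_nij_lie.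

Lemma skeletal_action x y h :
  l201 L (l200 L x y) h = l201 L x (l201 L y h) - l201 L y (l201 L x h).
Proof.
have := l3_bd x y h; rewrite sk (trilinear0r _ _ (l3_trilinear L)).
rewrite !l210E linearN /= => /eqP.
by rewrite eq_sym subr_eq0 => /eqP.
Qed.

Lemma skeletal_nij_action x h :
  l201 L (N x) (S h) = S (l201 L (N x) h + l201 L x (S h) - S (l201 L x h)).
Proof. by apply/esym/eqP; rewrite -subr_eq0 N_l201 sk linear0r. Qed.

Definition skeletal_rep : nijenhuis_rep skeletal_lie (L1 L) :=
  @NijenhuisRep _ _ skeletal_lie _ (l201 L) S
    skeletal_action skeletal_nij_action.

Definition skeletal_chi : cochain (L0 L) (L1 L) 3 :=
  Cochain (uncurry3_multilinear (l3_trilinear L))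
          (uncurry3_alternating (@l3_antisym _ L)).

Definition skeletal_F : cochain (L0 L) (L1 L) 2 :=
  Cochain (uncurry2_multilinear (N2 (hnij L)))
          (uncurry2_alternating (@N2_antisym _ _ (hnij L))).

Lemma skeletal_deltaCE t : deltaCE skeletal_rep skeletal_chi t = 0.
Proof. by rewrite [t]tuple4_eta /deltaCE CE_formula3 l2_l3. Qed.

Lemma skeletal_dNS t :
  dNS skeletal_rep skeletal_F t - partialNS skeletal_rep skeletal_chi t = 0.
Proof.
rewrite [t]tuple3_eta dNS2; last exact: N2_antisym.
by rewrite partialNS3; apply/eqP; rewrite subr_eq0; apply/eqP; apply: N_l3.
Qed.

Definition skeletal_cocycle : cocycle3 skeletal_rep :=
  Cocycle3 skeletal_deltaCE skeletal_dNS.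

Definition cocycle_of_skeletal : nijenhuis_cocycle3 K :=
  NijenhuisCocycle3 skeletal_cocycle.

End SkeletalToCocycle.

(** * The skeletal algebra of a cocycle *)

Section CocycleToSkeletal.

Variables (K : fieldType) (c : nijenhuis_cocycle3 K).

Let g := cc_g c.
Let V := cc_V c.
Let A : nijenhuis_lie g := cc_lie c.
Let R : nijenhuis_rep A V := cc_rep c.
Let chi : cochain g V 3 := cc_chi (cc_cocycle c).
Let F : cochain g V 2 := cc_F (cc_cocycle c).
Let l3c := curry3 chi.

Definition cocycle_bd : {linear V -> g} := \0.

Definition cocycle_N2 : {bilinear g -> g -> V} :=
  pack_bilinear (curry2_linearl F) (curry2_linearr F).

Lemma cocycle_bdE h : cocycle_bd h = 0.
Proof. by []. Qed.

Lemma cocycle_bd_l2 x h : cocycle_bd (rho R x h) = lie A x (cocycle_bd h).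
Proof. by rewrite !cocycle_bdE linear0r. Qed.

Lemma cocycle_l2_bd h k :
  rho R (cocycle_bd h) k = opp_flip (rho R) h (cocycle_bd k).
Proof. by rewrite !cocycle_bdE linear0l linear0r. Qed.

Lemma cocycle_bd_l3 x y z :
  cocycle_bd (l3c x y z) =
    lie A x (lie A y z) + lie A y (lie A z x) + lie A z (lie A x y).
Proof. by rewrite lie_jacobi. Qed.

Lemma cocycle_l3_bd x y h :
  l3c x y (cocycle_bd h) =
    rho R x (rho R y h) + rho R y (opp_flip (rho R) h x)
    + opp_flip (rho R) h (lie A x y).
Proof.
rewrite /l3c cocycle_bdE (trilinear0r _ _ (curry3_trilinear chi)) /=.
by rewrite rho_lie linearN /= subrr.
Qed.

Lemma cocycle_l2_l3 x y z w :
    rho R x (l3c y z w) - rho R y (l3c x z w) + rho R z (l3c x y w)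
    - rho R w (l3c x y z) - l3c (lie A x y) z w + l3c (lie A x z) y w
    - l3c (lie A x w) y z - l3c (lie A y z) x w + l3c (lie A y w) x z
    - l3c (lie A z w) x y = 0.
Proof.
by rewrite -CE_formula3 curry3K; apply: (cc_deltaCE (cc_cocycle c)).
Qed.

Definition linfty2_of_cocycle : linfty2 K :=
  @LInfty2 K g V cocycle_bd (lie A) (rho R) (opp_flip (rho R)) l3c
    (lie_antisym A) (fun _ _ => erefl) (curry3_trilinear chi)
    (curry3_antisym chi) cocycle_bd_l2 cocycle_l2_bd cocycle_bd_l3
    cocycle_l3_bd cocycle_l2_l3.

Lemma cocycle_N_bd h : cocycle_bd (nijV R h) = nij A (cocycle_bd h).
Proof. by rewrite !cocycle_bdE linear0. Qed.

Lemma cocycle_N_l200 x y :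
  nij A (deformed (lie A) (nij A) x y) - lie A (nij A x) (nij A y) =
    cocycle_bd (cocycle_N2 x y).
Proof. by rewrite nij_lie subrr. Qed.

Lemma cocycle_N_l201 x h :
  nijV R (rho R (nij A x) h + rho R x (nijV R h) - nijV R (rho R x h))
  - rho R (nij A x) (nijV R h) = cocycle_N2 x (cocycle_bd h).
Proof. by rewrite nij_rho subrr cocycle_bdE linear0r. Qed.

Lemma cocycle_N_l3 x y z :
  let lieN := deformed (lie A) (nij A) in
  let N := nij A in let S := nijV R in
  let N2c := cocycle_N2 in
  rho R (N x) (N2c y z) + rho R (N y) (N2c z x) + rho R (N z) (N2c x y)
  - N2c (lieN x y) z - N2c (lieN y z) x - N2c (lieN z x) y
  - S (rho R x (N2c y z) + rho R y (N2c z x) + rho R z (N2c x y)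
       - N2c (lie A x y) z - N2c (lie A y z) x - N2c (lie A z x) y)
  = l3c (N x) (N y) (N z)
    - S (l3c (N x) (N y) z + l3c (N x) y (N z) + l3c x (N y) (N z))
    + S (S (l3c (N x) y z + l3c x (N y) z + l3c x y (N z)))
    - S (S (S (l3c x y z))).
Proof.
move=> lieN N S N2c; rewrite -dNS2; last exact: curry2_antisym.
have N2cK : uncurry2 N2c = F by apply: curry2K.
rewrite -partialNS3 N2cK curry3K; apply/eqP; rewrite -subr_eq0; apply/eqP.
exact: (cc_dNS (cc_cocycle c)).
Qed.

Definition hnij_of_cocycle : homotopy_nijenhuis linfty2_of_cocycle :=
  @HomotopyNijenhuis K linfty2_of_cocycle (nij A) (nijV R) cocycle_N2
    (curry2_antisym F) cocycle_N_bd cocycle_N_l200 cocycle_N_l201 cocycle_N_l3.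

Definition skeletal_of_cocycle : nijenhuis_linfty2 K :=
  NijenhuisLInfty2 hnij_of_cocycle.

Lemma skeletal_of_cocycleP : skeletal skeletal_of_cocycle.
Proof. exact: cocycle_bdE. Qed.

End CocycleToSkeletal.

(** * The common underlying data *)

Section Data.

Variable K : fieldType.

(** Equality of the dependent records can only be tested after identifying
    their carriers and operations; plain functions without axioms make this
    possible, because equality of such data is easy to prove and to invert. *)
Record nijenhuis_data := NijenhuisData {
  data_g : lmodType K;
  data_V : lmodType K;
  data_br : data_g -> data_g -> data_g;
  data_rho : data_g -> data_V -> data_V;
  data_N : data_g -> data_g;
  data_S : data_V -> data_V;
  data_chi : data_g -> data_g -> data_g -> data_V;
  data_F : data_g -> data_g -> data_V
}.

Definition data_of_linfty2 (L : nijenhuis_linfty2 K) :=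
  NijenhuisData (l200 L) (l201 L) (N0 (hnij L)) (N1 (hnij L)) (@l3 _ L)
    (N2 (hnij L)).

Definition data_of_cocycle (c : nijenhuis_cocycle3 K) :=
  NijenhuisData (lie (cc_lie c)) (rho (cc_rep c)) (nij (cc_lie c))
    (nijV (cc_rep c)) (curry3 (cc_chi (cc_cocycle c)))
    (curry2 (cc_F (cc_cocycle c))).

Lemma data_cocycle_of_skeletal (L : nijenhuis_linfty2 K) (sk : skeletal L) :
  data_of_cocycle (cocycle_of_skeletal sk) = data_of_linfty2 L.
Proof. by []. Qed.

Lemma data_skeletal_of_cocycle (c : nijenhuis_cocycle3 K) :
  data_of_linfty2 (skeletal_of_cocycle c) = data_of_cocycle c.
Proof. by []. Qed.

(* The fields of the data depend on the carriers, so injectivity of the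
   constructor yields equalities of dependent pairs. *)
Ltac data_injection e :=
  injection e; clear e; intros;
  repeat match goal with
  | e : existT _ _ _ = existT _ _ _ |- _ => apply inj_pair2 in e
  | _ => progress subst
  end.

(* Identifies two structures whose underlying functions are equal, together
   with the proofs of axioms whose statements have thereby become the same. *)
Ltac subst_structures :=
  repeat match goal with
  | e : GRing.Linear.sort _ = GRing.Linear.sort _ |- _ =>
      apply linear_fun_inj in e
  | e : Bilinear.sort _ = Bilinear.sort _ |- _ => apply bilinear_fun_inj in e
  | e : curry2 _ = curry2 _ |- _ => apply cochain_curry2_inj in e
  | e : curry3 _ = curry3 _ |- _ => apply cochain_curry3_inj in e
  | _ => progress subst
  | p : ?P, q : ?P |- _ => destruct (proof_irrelevance P p q)
  end.

Lemma data_of_linfty2_inj (L L' : nijenhuis_linfty2 K) :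
    skeletal L -> skeletal L' ->
  data_of_linfty2 L = data_of_linfty2 L' -> L = L'.
Proof.
case: L => [[U V b br r s f ? sE ? ? ? ? ? ? ?] [N S F ? ? ? ? ?]] /= sk.
case: L' =>
  [[U' V' b' br' r' s' f' ? sE' ? ? ? ? ? ? ?] [N' S' F' ? ? ? ? ?]] /= sk' e.
rewrite /data_of_linfty2 /= in e; data_injection e.
have eb : b = b'.
  by apply/linear_fun_inj/functional_extensionality => h; rewrite [LHS]sk sk'.
subst_structures.
have es : s = s'.
  apply/bilinear_fun_inj.
  by do 2!apply: functional_extensionality => ?; rewrite sE sE'.
by subst_structures.
Qed.

Lemma data_of_cocycle_inj (c c' : nijenhuis_cocycle3 K) :
  data_of_cocycle c = data_of_cocycle c' -> c = c'.
Proof.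
case: c => [U V [br N ? ? ?] [r S ? ?] [chi F ? ?]].
case: c' => [U' V' [br' N' ? ? ?] [r' S' ? ?] [chi' F' ? ?]] e.
by rewrite /data_of_cocycle /= in e; data_injection e; subst_structures.
Qed.

End Data.

(** * The correspondence *)

Theorem theorem5p4 (K : fieldType) :
  exists Phi : {L : nijenhuis_linfty2 K | skeletal L} -> nijenhuis_cocycle3 K,
    bijective Phi /\
    forall (L : nijenhuis_linfty2 K) (sk : skeletal L),
      exists (A : nijenhuis_lie (L0 L)) (R : nijenhuis_rep A (L1 L))
             (c : cocycle3 R),
        Phi (exist _ L sk) = NijenhuisCocycle3 c /\
        [/\ forall x y, lie A x y = l200 L x y,
            forall x, nij A x = N0 (hnij L) x,
            forall x h, rho R x h = l201 L x h &
            forall h, nijV R h = N1 (hnij L) h] /\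
        (forall x y z, cc_chi c [tuple x; y; z] = l3 x y z) /\
        (forall x y, cc_F c [tuple x; y] = N2 (hnij L) x y).
Proof.
exists (fun s => cocycle_of_skeletal (proj2_sig s)); split; last first.
  move=> L sk.
  by exists (skeletal_lie sk), (skeletal_rep sk), (skeletal_cocycle sk).
exists (fun c =>
  exist (@skeletal K) (skeletal_of_cocycle c) (@skeletal_of_cocycleP K c)).
- move=> [L sk]; apply/subset_eq_compat/data_of_linfty2_inj.
  + exact: skeletal_of_cocycleP.
  + exact: sk.
  + by rewrite data_skeletal_of_cocycle data_cocycle_of_skeletal.
- move=> c; apply: data_of_cocycle_inj.
  by rewrite data_cocycle_of_skeletal data_skeletal_of_cocycle.
Qed.
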